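(* Let $0<a<b<1$ with $b<(a+2)/3$, let $\kappa<0$, and let $D$, $\Phi$, $R$ be as in the context, so that $u=0$ and $u=1$ are constant solutions of $u_t=(D(u)u_x)_x+R(u)$. For a constant solution $\bar u\in\{0,1\}$, consider the dispersion relation $$\lambda(\alpha)=-\alpha^2D(\bar u)+R'(\bar u),\qquad \alpha\in\mathbb{R},$$ of the linearised equation $p_t=D(\bar u)p_{xx}+R'(\bar u)p$ for perturbations $p\in L^2(\mathbb{R})$. Then: (i) the constant solution $u=0$ is linearly stable: $R'(0)<0$, and so $\lambda(\alpha)<0$ for all $\alpha\in\mathbb{R}$; (ii) for the constant solution $u=1$, $R'(1)$ is positive if $a+b>1$, zero if $a+b=1$, and negative if $a+b<1$. Consequently, if $a+b<1$ then $u=1$ is linearly stable ($\lambda(\alpha)<0$ for all $\alpha\in\mathbb{R}$), while if $a+b>1$ then $u=1$ has a long-wavelength instability ($\lambda(\alpha)>0$ for all sufficiently small $|\alpha|$).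
   Context: Here $D(u)=(u-a)(u-b)$ and $\Phi(u)=\int_1^uD(s)\,ds$. With $A=-\kappa D(0)>0$, $$R(u)=\left(\frac{A}{D(u)}+\kappa\right)\Phi(u),$$ so that $R(0)=R(1)=0$. The condition $b<(a+2)/3$ guarantees $\Phi(u)<0$ for $u\in[0,1)$. The dispersion relation is obtained by inserting $u=\bar u+\varepsilon p$, keeping terms of order $\varepsilon$, and seeking $p(x,t)=e^{\lambda t}p(x)$ with Fourier variable $\alpha$ in $x$. A constant solution is linearly stable to $L^2(\mathbb{R})$ perturbations if $\operatorname{Re}(\lambda(\alpha))<0$ for all $\alpha\in\mathbb{R}$; perturbations with $\operatorname{Re}(\lambda(\alpha))>0$ grow. *)

(* Defs.v *)
From Stdlib Require Import Reals.
From Coquelicot Require Import Coquelicot.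
Open Scope R_scope.

Definition diffusivity (a b u : R) : R := (u - a) * (u - b).

(* [RInt] is oriented: for [u < 1] this is minus the integral over [u, 1]. *)
Definition Phi (a b u : R) : R := RInt (diffusivity a b) 1 u.

Definition amplitude (a b kappa : R) : R := - kappa * diffusivity a b 0.

Definition reaction (a b kappa u : R) : R :=
  (amplitude a b kappa / diffusivity a b u + kappa) * Phi a b u.

(* Classical solutions of u_t = (D(u) u_x)_x + F(u), with [u x t].  [Derive] is
   total, so the existence of each derivative is required separately. *)
Definition solves_reaction_diffusion (D F : R -> R) (u : R -> R -> R) : Prop :=
  forall x t : R,
    ex_derive (fun s => u x s) t /\
    ex_derive (fun y => u y t) x /\
    ex_derive (fun y => D (u y t) * Derive (fun z => u z t) y) x /\
    Derive (fun s => u x s) t =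
      Derive (fun y => D (u y t) * Derive (fun z => u z t) y) x + F (u x t).

(* Complex-valued classical solutions of p_t = D(ubar) p_xx + F'(ubar) p, the
   linearisation of the equation above about the constant [ubar]. *)
Definition solves_linearised (D F : R -> R) (ubar : R) (p : R -> R -> C) : Prop :=
  exists pt px pxx : R -> R -> C, forall x t : R,
    is_derive (K := R_AbsRing) (V := C_R_NormedModule)
      (fun s => p x s) t (pt x t) /\
    is_derive (K := R_AbsRing) (V := C_R_NormedModule)
      (fun y => p y t) x (px x t) /\
    is_derive (K := R_AbsRing) (V := C_R_NormedModule)
      (fun y => px y t) x (pxx x t) /\
    pt x t = Cplus (Cmult (RtoC (D ubar)) (pxx x t))
                   (Cmult (RtoC (Derive F ubar)) (p x t)).

Definition cexp (z : C) : C :=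
  (exp (Re z) * cos (Im z), exp (Re z) * sin (Im z)).

(* The Fourier mode e^{lam t} e^{i alpha x}. *)
Definition fourier_mode (alpha : R) (lam : C) (x t : R) : C :=
  Cmult (cexp (Cmult lam (RtoC t))) (cexp (Cmult Ci (RtoC (alpha * x)))).

(* [lam] is a value at [alpha] of the dispersion relation about [ubar]. *)
Definition growth_rate (D F : R -> R) (ubar alpha : R) (lam : C) : Prop :=
  solves_linearised D F ubar (fourier_mode alpha lam).

Definition linearly_stable (D F : R -> R) (ubar : R) : Prop :=
  forall (alpha : R) (lam : C), growth_rate D F ubar alpha lam -> Re lam < 0.

Definition dispersion (D F : R -> R) (ubar alpha : R) : R :=
  - alpha ^ 2 * D ubar + Derive F ubar.

(* Main.v *)
Require Import Defs.
From Stdlib Require Import Reals Lra.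
From Coquelicot Require Import Coquelicot.
Open Scope R_scope.

(** The linearisation has constant coefficients, so a Fourier mode
    p = e^{lam t} e^{i alpha x} is an eigenfunction of both d/dt and d^2/dx^2,
    with eigenvalues lam and - alpha^2.  As p never vanishes, it solves the
    linearised equation exactly when lam = - alpha^2 D(ubar) + F'(ubar)
    ([growth_rate_iff]); stability is thus decided by the signs of D and F' at
    the two constant states.  There D(0) = a b and D(1) = (1 - a)(1 - b) are
    positive, so everything rests on the sign of F'.

    With A = - kappa D(0) the product rule gives
    F' = - A D' Phi / D^2 + (A / D + kappa) D, and one term drops out at each
    state.  At 0 the factor A / D + kappa vanishes, which leaves
    F'(0) = - kappa (a + b) / (a b) * Phi(0) ([is_derive_reaction_0]), whose
    sign is that of Phi(0); the condition b < (a + 2) / 3 makes it negative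
    ([Phi_0_neg]).  At 1 the factor Phi vanishes, which leaves
    F'(1) = kappa (D(1) - D(0)) = kappa (1 - (a + b))
    ([is_derive_reaction_1]). *)

(** * Derivatives of complex-valued functions of a real variable *)

Lemma is_derive_C_intro (f : R -> C) (x : R) (l : C) :
  is_derive (fun s => Re (f s)) x (Re l) ->
  is_derive (fun s => Im (f s)) x (Im l) ->
  is_derive (K := R_AbsRing) (V := C_R_NormedModule) f x l.
Proof.
  intros Hre Him.
  apply (is_derive_ext (K := R_AbsRing) (V := C_R_NormedModule)
           (fun s => (Re (f s), Im (f s)))).
  { intros s; now destruct (f s). }
  apply (filterdiff_ext_lin (K := R_AbsRing) (U := R_NormedModule)
           (V := C_R_NormedModule) _
           (fun y => (scal y (Re l), scal y (Im l)))).
  2: { intros y; now destruct l. }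
  apply (filterdiff_comp_2 (K := R_AbsRing) (T := R_NormedModule)
           (U := R_NormedModule) (V := R_NormedModule) (W := C_R_NormedModule)
           (fun s => Re (f s)) (fun s => Im (f s)) (fun u v => (u, v))
           (fun y => scal y (Re l)) (fun y => scal y (Im l))
           (fun u v => (u, v))).
  - exact Hre.
  - exact Him.
  - apply (filterdiff_ext_lin (K := R_AbsRing)
             (U := prod_NormedModule R_AbsRing R_NormedModule R_NormedModule)
             (V := C_R_NormedModule) _ (fun t => t)).
    + apply (filterdiff_ext (K := R_AbsRing)
             (U := prod_NormedModule R_AbsRing R_NormedModule R_NormedModule)
             (V := C_R_NormedModule) (fun t => t)).
      * now intros [u v].
      * apply filterdiff_id.
    + now intros [u v].
Qed.

Lemma is_derive_C_elim (f : R -> C) (x : R) (l : C) :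
  is_derive (K := R_AbsRing) (V := C_R_NormedModule) f x l ->
  is_derive (fun s => Re (f s)) x (Re l) /\
  is_derive (fun s => Im (f s)) x (Im l).
Proof.
  intros H; split.
  - apply (filterdiff_comp' (K := R_AbsRing) (U := R_NormedModule)
             (V := C_R_NormedModule) (W := R_NormedModule)
             f (fun z : C => fst z) x (fun y => scal y l) (fun z : C => fst z) H).
    apply filterdiff_linear, is_linear_fst.
  - apply (filterdiff_comp' (K := R_AbsRing) (U := R_NormedModule)
             (V := C_R_NormedModule) (W := R_NormedModule)
             f (fun z : C => snd z) x (fun y => scal y l) (fun z : C => snd z) H).
    apply filterdiff_linear, is_linear_snd.
Qed.

Lemma is_derive_C_unique (f : R -> C) (x : R) (l1 l2 : C) :
  is_derive (K := R_AbsRing) (V := C_R_NormedModule) f x l1 ->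
  is_derive (K := R_AbsRing) (V := C_R_NormedModule) f x l2 ->
  l1 = l2.
Proof.
  intros H1 H2.
  destruct (is_derive_C_elim _ _ _ H1) as [R1 I1].
  destruct (is_derive_C_elim _ _ _ H2) as [R2 I2].
  apply injective_projections.
  - exact (eq_trans (eq_sym (is_derive_unique _ _ _ R1)) (is_derive_unique _ _ _ R2)).
  - exact (eq_trans (eq_sym (is_derive_unique _ _ _ I1)) (is_derive_unique _ _ _ I2)).
Qed.

Lemma is_derive_C_scal (c : C) (f : R -> C) (x : R) (l : C) :
  is_derive (K := R_AbsRing) (V := C_R_NormedModule) f x l ->
  is_derive (K := R_AbsRing) (V := C_R_NormedModule)
    (fun s => Cmult c (f s)) x (Cmult c l).
Proof.
  intros H; destruct (is_derive_C_elim _ _ _ H) as [Hre Him].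
  apply is_derive_C_intro.
  - apply (is_derive_minus (K := R_AbsRing) (V := R_NormedModule)
             (fun s => Re c * Re (f s)) (fun s => Im c * Im (f s)));
      now apply is_derive_scal.
  - apply (is_derive_plus (K := R_AbsRing) (V := R_NormedModule)
             (fun s => Re c * Im (f s)) (fun s => Im c * Re (f s)));
      now apply is_derive_scal.
Qed.

Lemma is_derive_cexp_line (z : C) (x : R) :
  is_derive (K := R_AbsRing) (V := C_R_NormedModule)
    (fun s => cexp (Cmult z (RtoC s))) x
    (Cmult z (cexp (Cmult z (RtoC x)))).
Proof.
  destruct z as [r i].
  apply is_derive_C_intro; unfold cexp; simpl; auto_derive; trivial.
  (* The arguments of exp must agree syntactically for [ring]. *)
  all: replace (r * x + - (i * 0)) with (r * x - i * 0) by ring; ring.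
Qed.

Lemma cexp_neq_0 (z : C) : cexp z <> RtoC 0.
Proof.
  intros H; injection H as Hre Him.
  pose proof (exp_pos (Re z)) as He.
  (* The cosine and the sine of the same angle would both be zero. *)
  apply Rmult_integral in Hre, Him.
  pose proof (sin2_cos2 (Im z)) as Hsc; unfold Rsqr in Hsc.
  destruct Hre as [Hre | Hre]; [lra |].
  destruct Him as [Him | Him]; [lra |].
  rewrite Hre, Him in Hsc; lra.
Qed.

(** * The dispersion relation *)

Lemma is_derive_fourier_mode_t (alpha : R) (lam : C) (x t : R) :
  is_derive (K := R_AbsRing) (V := C_R_NormedModule)
    (fun s => fourier_mode alpha lam x s) t
    (Cmult lam (fourier_mode alpha lam x t)).
Proof.
  unfold fourier_mode.
  apply (is_derive_ext (K := R_AbsRing) (V := C_R_NormedModule)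
           (fun s => Cmult (cexp (Cmult Ci (RtoC (alpha * x))))
                           (cexp (Cmult lam (RtoC s))))).
  { intros s; apply Cmult_comm. }
  rewrite Cmult_assoc, (Cmult_comm (Cmult lam _)).
  apply is_derive_C_scal, is_derive_cexp_line.
Qed.

Lemma is_derive_fourier_mode_x (alpha : R) (lam : C) (x t : R) :
  is_derive (K := R_AbsRing) (V := C_R_NormedModule)
    (fun y => fourier_mode alpha lam y t) x
    (Cmult (Cmult Ci (RtoC alpha)) (fourier_mode alpha lam x t)).
Proof.
  unfold fourier_mode.
  assert (E : forall y, Cmult Ci (RtoC (alpha * y)) =
                        Cmult (Cmult Ci (RtoC alpha)) (RtoC y)).
  { intros y; rewrite RtoC_mult; apply Cmult_assoc. }
  apply (is_derive_ext (K := R_AbsRing) (V := C_R_NormedModule)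
           (fun y => Cmult (cexp (Cmult lam (RtoC t)))
                           (cexp (Cmult (Cmult Ci (RtoC alpha)) (RtoC y))))).
  { intros y; now rewrite E. }
  rewrite E, Cmult_assoc, (Cmult_comm (Cmult Ci _)), <- Cmult_assoc.
  apply is_derive_C_scal, is_derive_cexp_line.
Qed.

Lemma fourier_mode_neq_0 (alpha : R) (lam : C) (x t : R) :
  fourier_mode alpha lam x t <> RtoC 0.
Proof. apply Cmult_neq_0; apply cexp_neq_0. Qed.

(** Substituting the mode into the linearised equation multiplies it by lam on
    one side and by the dispersion value on the other, so the nonvanishing
    mode can be cancelled. *)
Lemma growth_rate_iff (D F : R -> R) (ubar alpha : R) (lam : C) :
  growth_rate D F ubar alpha lam <-> lam = RtoC (dispersion D F ubar alpha).
Proof.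
  set (p := fourier_mode alpha lam).
  set (ia := Cmult Ci (RtoC alpha)).
  assert (Hxx : forall x t, is_derive (K := R_AbsRing) (V := C_R_NormedModule)
            (fun y => Cmult ia (p y t)) x (Cmult ia (Cmult ia (p x t)))).
  { intros x t; apply is_derive_C_scal, is_derive_fourier_mode_x. }
  assert (Hrhs : forall x t,
            Cplus (Cmult (RtoC (D ubar)) (Cmult ia (Cmult ia (p x t))))
                  (Cmult (RtoC (Derive F ubar)) (p x t)) =
            Cmult (RtoC (dispersion D F ubar alpha)) (p x t)).
  { intros x t; destruct (p x t) as [pr pi]; unfold ia, dispersion.
    apply injective_projections; simpl; ring. }
  split.
  - intros (pt & px & pxx & H).
    assert (Epx : forall x, px x 0 = Cmult ia (p x 0)).
    { intros x; destruct (H x 0) as (_ & H2 & _).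
      exact (is_derive_C_unique _ _ _ _ H2 (is_derive_fourier_mode_x _ _ _ _)). }
    destruct (H 0 0) as (H1 & _ & H3 & H4).
    rewrite (is_derive_C_unique _ _ _ _ H1 (is_derive_fourier_mode_t _ _ _ _)) in H4.
    apply (is_derive_ext (K := R_AbsRing) (V := C_R_NormedModule) _ _ _ _ Epx) in H3.
    rewrite (is_derive_C_unique _ _ _ _ H3 (Hxx 0 0)) in H4.
    fold p in H4; rewrite Hrhs in H4.
    pose proof (fourier_mode_neq_0 alpha lam 0 0) as Hp; fold p in Hp.
    rewrite <- (Cmult_1_r lam), <- (Cinv_r _ Hp), Cmult_assoc, H4.
    now rewrite <- Cmult_assoc, (Cinv_r _ Hp), Cmult_1_r.
  - intros Hlam.
    exists (fun x t => Cmult lam (p x t)), (fun x t => Cmult ia (p x t)),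
           (fun x t => Cmult ia (Cmult ia (p x t))).
    intros x t; split; [| split; [| split]].
    + apply is_derive_fourier_mode_t.
    + apply is_derive_fourier_mode_x.
    + apply Hxx.
    + rewrite Hrhs, <- Hlam; reflexivity.
Qed.

Lemma linearly_stable_of_dispersion (D F : R -> R) (ubar : R) :
  (forall alpha : R, dispersion D F ubar alpha < 0) -> linearly_stable D F ubar.
Proof. intros H alpha lam ->%growth_rate_iff; exact (H alpha). Qed.

Lemma dispersion_neg (D F : R -> R) (ubar alpha : R) :
  0 <= D ubar -> Derive F ubar < 0 -> dispersion D F ubar alpha < 0.
Proof. unfold dispersion; intros HD HF; nra. Qed.

(** The diffusive decay alpha^2 D(ubar) is at most D(ubar) |alpha| for
    |alpha| < 1, hence below F'(ubar) once |alpha| < F'(ubar) / D(ubar). *)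
Lemma long_wave_instability (D F : R -> R) (ubar : R) :
  0 < D ubar -> Derive F ubar > 0 ->
  exists delta : R, 0 < delta /\
    forall alpha : R, Rabs alpha < delta -> dispersion D F ubar alpha > 0.
Proof.
  intros HD HF; exists (Rmin 1 (Derive F ubar / D ubar)); split.
  { apply Rmin_glb_lt; [lra | now apply Rdiv_lt_0_compat]. }
  intros alpha [H1 H2]%Rmin_Rgt; unfold dispersion.
  rewrite <- pow2_abs.
  pose proof (Rabs_pos alpha) as H0.
  apply (Rmult_lt_compat_r (D ubar)) in H2; [| exact HD].
  replace (Derive F ubar / D ubar * D ubar) with (Derive F ubar) in H2 by (field; lra).
  assert (Rabs alpha ^ 2 * D ubar <= Rabs alpha * D ubar).
  { apply Rmult_le_compat_r; nra. }
  lra.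
Qed.

Lemma constant_solution (D F : R -> R) (ubar : R) :
  F ubar = 0 -> solves_reaction_diffusion D F (fun _ _ => ubar).
Proof.
  intros HF x t.
  assert (Hflux : forall y, 0 = D ubar * Derive (fun _ => ubar) y).
  { intros y; rewrite Derive_const; ring. }
  repeat split; try apply ex_derive_const.
  - apply (ex_derive_ext (fun _ => 0)); [exact Hflux | apply ex_derive_const].
  - rewrite <- (Derive_ext (fun _ => 0) _ x Hflux), !Derive_const, HF; ring.
Qed.

(** * The reaction term at the two constant states *)

Lemma Phi_closed_form (a b u : R) :
  Phi a b u = (u ^ 3 - 1) / 3 - (a + b) * (u ^ 2 - 1) / 2 + a * b * (u - 1).
Proof.
  unfold Phi; apply is_RInt_unique.
  set (P := fun v : R => v ^ 3 / 3 - (a + b) * v ^ 2 / 2 + a * b * v).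
  replace (_ + _) with (minus (P u) (P 1))
    by (unfold minus, plus, opp, P; simpl; field).
  apply (is_RInt_derive P).
  - intros v _; unfold P, diffusivity; auto_derive; trivial; field.
  - intros v _; apply (ex_derive_continuous (diffusivity a b)).
    unfold diffusivity; auto_derive; trivial.
Qed.

Lemma is_derive_Phi (a b u : R) : is_derive (Phi a b) u (diffusivity a b u).
Proof.
  eapply is_derive_ext; [intros v; symmetry; apply Phi_closed_form |].
  unfold diffusivity; auto_derive; trivial; field.
Qed.

Lemma Phi_1 (a b : R) : Phi a b 1 = 0.
Proof. rewrite Phi_closed_form; field. Qed.

Lemma Phi_0_neg (a b : R) :
  0 < a -> a < b -> b < (a + 2) / 3 -> Phi a b 0 < 0.
Proof.
  intros ha hab hba; rewrite Phi_closed_form.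
  enough (0 < 2 - 3 * (a + b) + 6 * a * b) by lra.
  (* The expression is affine in b with slope 3 (2 a - 1), so it is bounded
     below by an endpoint value: 2 a^2 at b = (a + 2) / 3 when the slope is not
     positive, and 6 a^2 - 6 a + 2 > 0 at b = a otherwise. *)
  destruct (Rle_lt_dec a (1 / 2)).
  - assert (0 <= (1 - 2 * a) * (a + 2 - 3 * b)) by (apply Rmult_le_pos; lra).
    nra.
  - assert (0 <= (2 * a - 1) * (b - a)) by (apply Rmult_le_pos; lra).
    nra.
Qed.

Lemma is_derive_reaction (a b kappa u : R) :
  diffusivity a b u <> 0 ->
  is_derive (reaction a b kappa) u
    (- amplitude a b kappa * (2 * u - (a + b)) / diffusivity a b u ^ 2 * Phi a b u
     + (amplitude a b kappa / diffusivity a b u + kappa) * diffusivity a b u).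
Proof.
  intros Hu.
  apply (is_derive_mult (K := R_AbsRing)
           (fun v => amplitude a b kappa / diffusivity a b v + kappa) (Phi a b)).
  - revert Hu; unfold diffusivity; intros Hu.
    auto_derive; [exact Hu | field; split; intros H0; apply Hu; rewrite H0; ring].
  - apply is_derive_Phi.
  - intros r s; apply Rmult_comm.
Qed.

Lemma reaction_0 (a b kappa : R) :
  diffusivity a b 0 <> 0 -> reaction a b kappa 0 = 0.
Proof. intros H0; unfold reaction, amplitude; field; exact H0. Qed.

Lemma reaction_1 (a b kappa : R) : reaction a b kappa 1 = 0.
Proof. unfold reaction; rewrite Phi_1; ring. Qed.

Lemma is_derive_reaction_0 (a b kappa : R) :
  a <> 0 -> b <> 0 ->
  is_derive (reaction a b kappa) 0 (- kappa * (a + b) / (a * b) * Phi a b 0).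
Proof.
  intros ha hb.
  evar_last.
  - apply is_derive_reaction; unfold diffusivity.
    replace ((0 - a) * (0 - b)) with (a * b) by ring.
    now apply Rmult_integral_contrapositive.
  - unfold amplitude, diffusivity; field; lra.
Qed.

Lemma is_derive_reaction_1 (a b kappa : R) :
  a <> 1 -> b <> 1 ->
  is_derive (reaction a b kappa) 1 (kappa * (1 - (a + b))).
Proof.
  intros ha hb.
  evar_last.
  - apply is_derive_reaction, Rmult_integral_contrapositive; lra.
  - rewrite Phi_1; unfold amplitude, diffusivity; field; lra.
Qed.

(** * Stability of the constant states *)

Theorem mainTheorem2 (a b kappa : R)
    (ha : 0 < a) (hab : a < b) (hb : b < 1) (hba : b < (a + 2) / 3)
    (hkappa : kappa < 0) :
  let D := diffusivity a b in
  let F := reaction a b kappa in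
  (forall ubar : R, ubar = 0 \/ ubar = 1 ->
     solves_reaction_diffusion D F (fun _ _ => ubar) /\
     ex_derive F ubar /\
     (forall (alpha : R) (lam : C),
        growth_rate D F ubar alpha lam <->
        lam = RtoC (dispersion D F ubar alpha))) /\
  (Derive F 0 < 0 /\
   (forall alpha : R, dispersion D F 0 alpha < 0) /\
   linearly_stable D F 0) /\
  ((a + b > 1 -> Derive F 1 > 0) /\
   (a + b = 1 -> Derive F 1 = 0) /\
   (a + b < 1 -> Derive F 1 < 0) /\
   (a + b < 1 ->
      (forall alpha : R, dispersion D F 1 alpha < 0) /\
      linearly_stable D F 1) /\
   (a + b > 1 ->
      exists delta : R, 0 < delta /\
        forall alpha : R, Rabs alpha < delta -> dispersion D F 1 alpha > 0)).
Proof.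
  intros D F.
  assert (HD0 : 0 < D 0) by (unfold D, diffusivity; nra).
  assert (HD1 : 0 < D 1) by (unfold D, diffusivity; nra).
  assert (H0 : is_derive F 0 (- kappa * (a + b) / (a * b) * Phi a b 0)).
  { apply is_derive_reaction_0; lra. }
  assert (H1 : is_derive F 1 (kappa * (1 - (a + b)))).
  { apply is_derive_reaction_1; lra. }
  pose proof (is_derive_unique _ _ _ H0) as E0.
  assert (HF0 : Derive F 0 < 0).
  { pose proof (Phi_0_neg a b ha hab hba) as HPhi.
    assert (0 < - kappa * (a + b) / (a * b)).
    { apply Rdiv_lt_0_compat; nra. }
    rewrite E0; nra. }
  assert (HF1 : Derive F 1 = kappa * (1 - (a + b))) by exact (is_derive_unique _ _ _ H1).
  split; [| split].
  - intros ubar Hubar; split; [| split].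
    + apply constant_solution.
      destruct Hubar as [-> | ->]; [apply reaction_0; fold D; lra | apply reaction_1].
    + destruct Hubar as [-> | ->]; eexists; [exact H0 | exact H1].
    + intros alpha lam; apply growth_rate_iff.
  - assert (Hdisp : forall alpha, dispersion D F 0 alpha < 0).
    { intros alpha; apply dispersion_neg; lra. }
    split; [exact HF0 | split; [exact Hdisp |]].
    now apply linearly_stable_of_dispersion.
  - assert (Hpos : a + b > 1 -> Derive F 1 > 0) by (rewrite HF1; nra).
    assert (Hneg : a + b < 1 -> Derive F 1 < 0) by (rewrite HF1; nra).
    split; [exact Hpos |].
    split; [intros E; rewrite HF1, E; ring |].
    split; [exact Hneg |].
    split.
    + intros Hab1.
      assert (Hdisp : forall alpha, dispersion D F 1 alpha < 0).
      { intros alpha; apply dispersion_neg; [lra | now apply Hneg]. }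
      split; [exact Hdisp | now apply linearly_stable_of_dispersion].
    + intros Hab1; apply long_wave_instability; [exact HD1 | now apply Hpos].
Qed.
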